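(* Let $\delta=(E,\#,\mapsto)$ be a DES, let $\{(X_i,y_i)\}_{i\in I}$ enumerate its bundles ($X_i\mapsto y_i$), and let $\{x_i\}_{i\in I}$ be pairwise distinct fresh events not in $E$. Let $\mathrm{ses}(\delta)=(E',\#,\to,\mathrm{Drop})$ with $E'=E\cup\{x_i\}_{i\in I}$, $\to\,=\{(x_i,y_i)\mid i\in I\}\cup\{(x_i,x_i)\mid i\in I\}$, and $\mathrm{Drop}=\{(d,x_i,y_i)\mid i\in I,\ d\in X_i\}$. Then $\delta$ and $\mathrm{ses}(\delta)$ have the same set of posets.
   Context: An SES is a tuple $\sigma=(E,\#,\to,\mathrm{Drop})$: $E$ a set of events, $\#\subseteq E^2$ irreflexive and symmetric, $\to\subseteq E^2$, $\mathrm{Drop}\subseteq E^3$ with $(d,c,t)\in\mathrm{Drop}$ implying $c\to t$ and $d\notin\{c,t\}$. Let $\mathrm{ic}(e)=\{e'\mid e'\to e\}$ and $\mathrm{dc}(H,e)=\{e'\mid\exists d\in H.(d,e',e)\in\mathrm{Drop}\}$. For $t=e_1\cdots e_n$ write $\overline t=\{e_1,\dots,e_n\}$, $t_i=e_1\cdots e_i$. A trace of $\sigma$ is a sequence of pairwise distinct events with no two in conflict and $\mathrm{ic}(e_i)\setminus\mathrm{dc}(\overline{t_{i-1}},e_i)\subseteq\overline{t_{i-1}}$ for all $i$. A DES is $\delta=(E,\#,\mapsto)$ with $\#$ irreflexive symmetric and $\mapsto\subseteq\mathcal P(E)\times E$ (bundles). A trace of $\delta$ is a sequence of pairwise distinct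 conflict-free events such that every bundle $X\mapsto e_i$ satisfies $X\cap\overline{t_{i-1}}\neq\emptyset$. Posets (early causality): for a trace $t=e_1\cdots e_n$ and sets $U_1\ne U_2$ of events of $t$, $U_1$ is earlier than $U_2$ if the largest index $j$ with $e_j\in U_1\setminus U_2$ is smaller than the largest index $j$ with $e_j\in U_2\setminus U_1$. In a DES the cause $U_i$ of $e_i$ in $t$ is the earliest $U\subseteq\overline{t_{i-1}}$ meeting every bundle pointing to $e_i$; in an SES it is the earliest $U\subseteq\overline{t_{i-1}}$ with $\mathrm{ic}(e_i)\setminus\mathrm{dc}(U,e_i)\subseteq U$. The poset of $t$ is $(\overline t,\le)$ with $\le$ the reflexive transitive closure of $\{(c,e_i)\mid c\in U_i\}$; the set of posets of a structure is the set of posets of all its traces. *)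

(* Defs.v *)
From Stdlib Require Export Relation_Operators.
From mathcomp Require Export all_boot.
From mathcomp Require Export boolp classical_sets.

Set Implicit Arguments.
Unset Strict Implicit.
Unset Printing Implicit Defensive.

Local Open Scope classical_set_scope.

(* Events live in an ambient type T; the event set of a structure is a subset
   of T, so that a structure over E and one over E' = E + fresh events can be
   compared literally. The records carry the bare tuples, and the axioms are
   the predicates is_des and is_ses. *)

Record des (T : Type) := DES {
  des_events : set T;
  des_conflict : T -> T -> Prop;
  des_bundle : set T -> T -> Prop }.

Record ses (T : Type) := SES {
  ses_events : set T;
  ses_conflict : T -> T -> Prop;
  ses_causality : T -> T -> Prop;
  ses_drop : T -> T -> T -> Prop }.

Definition is_conflict (T : Type) (E : set T) (cf : T -> T -> Prop) : Prop :=
  [/\ forall a b, cf a b -> E a /\ E b,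
      forall a, ~ cf a a
    & forall a b, cf a b -> cf b a].

Definition is_des (T : Type) (d : des T) : Prop :=
  is_conflict (des_events d) (des_conflict d) /\
  (forall X e, des_bundle d X e -> X `<=` des_events d /\ des_events d e).

Definition is_ses (T : Type) (s : ses T) : Prop :=
  [/\ is_conflict (ses_events s) (ses_conflict s),
      forall c e, ses_causality s c e -> ses_events s c /\ ses_events s e
    & forall m c e, ses_drop s m c e ->
        [/\ ses_events s m, ses_causality s c e, m <> c & m <> e]].

Definition ic (T : Type) (s : ses T) (e : T) : set T :=
  [set c | ses_causality s c e].

Definition dc (T : Type) (s : ses T) (H : set T) (e : T) : set T :=
  [set c | exists2 m, H m & ses_drop s m c e].

(* Enabling of e by a set of events U: both the trace condition
   (U = the events preceding e) and the candidate causes are instances. *)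

Definition des_enables (T : Type) (d : des T) (U : set T) (e : T) : Prop :=
  forall X, des_bundle d X e -> X `&` U !=set0.

Definition ses_enables (T : Type) (s : ses T) (U : set T) (e : T) : Prop :=
  ic s e `\` dc s U e `<=` U.

(* Indices are 0-based: for i : 'I_(size t), [ev i] is e_(i+1) in 1-based
   notation and [before i] is the set of events of the prefix t_i. *)

Definition ev (T : Type) (t : seq T) (i : 'I_(size t)) : T :=
  tnth (in_tuple t) i.

Definition before (T : eqType) (t : seq T) (i : 'I_(size t)) : set T :=
  [set` take i t].

Definition is_trace (T : eqType) (E : set T) (cf : T -> T -> Prop)
    (enables : set T -> T -> Prop) (t : seq T) : Prop :=
  [/\ [set` t] `<=` E,
      uniq t,
      forall a b, a \in t -> b \in t -> ~ cf a b
    & forall i : 'I_(size t), enables (before i) (ev i)].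

(* The largest 1-based index in t of an event of U, and 0 if there is none. *)
Definition last_index (T : Type) (t : seq T) (U : set T) : nat :=
  \max_(i < size t | `[< U (ev i) >]) i.+1.

Definition earlier (T : Type) (t : seq T) (U1 U2 : set T) : Prop :=
  last_index t (U1 `\` U2) < last_index t (U2 `\` U1).

Definition is_cause (T : eqType) (enables : set T -> T -> Prop) (t : seq T)
    (i : 'I_(size t)) (U : set T) : Prop :=
  [/\ U `<=` before i,
      enables U (ev i)
    & forall V : set T, V `<=` before i -> enables V (ev i) -> V <> U ->
        earlier t U V].

Definition precedes (T : eqType) (enables : set T -> T -> Prop) (t : seq T)
    (c e : T) : Prop :=
  exists (i : 'I_(size t)) (U : set T),
    [/\ e = ev i, is_cause enables i U & U c].

(* A poset is given by its carrier and the graph of its order relation. *)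
Definition poset (T : Type) : Type := (set T * set (T * T))%type.

Definition trace_poset (T : eqType) (enables : set T -> T -> Prop)
    (t : seq T) : poset T :=
  ([set` t],
   [set p | [/\ p.1 \in t, p.2 \in t
              & clos_refl_trans T (precedes enables t) p.1 p.2]]).

Definition des_trace (T : eqType) (d : des T) : set (seq T) :=
  is_trace (des_events d) (des_conflict d) (des_enables d).

Definition ses_trace (T : eqType) (s : ses T) : set (seq T) :=
  is_trace (ses_events s) (ses_conflict s) (ses_enables s).

Definition des_posets (T : eqType) (d : des T) : set (poset T) :=
  trace_poset (des_enables d) @` des_trace d.

Definition ses_posets (T : eqType) (s : ses T) : set (poset T) :=
  trace_poset (ses_enables s) @` ses_trace s.

Definition enumerates_bundles (T : Type) (d : des T) (I : Type)
    (X : I -> set T) (y : I -> T) : Prop :=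
  forall A e, des_bundle d A e <-> exists i, A = X i /\ e = y i.

Definition ses_of_des (T : Type) (d : des T) (I : Type)
    (X : I -> set T) (y x : I -> T) : ses T := {|
  ses_events := des_events d `|` range x;
  ses_conflict := des_conflict d;
  ses_causality := fun c e => exists i, c = x i /\ (e = y i \/ e = x i);
  ses_drop := fun m c e => exists i, [/\ c = x i, e = y i & X i m] |}.

(* A bundle X |-> e with e in X gives a drop (e, x_i, e), which the axioms of
   an SES exclude; this is the only obstruction to well-formedness. *)
Lemma ses_of_des_is_ses (T : Type) (d : des T) (I : Type)
    (X : I -> set T) (y x : I -> T) :
  is_des d -> enumerates_bundles d X y ->
  (forall i, ~ des_events d (x i)) -> (forall i, ~ X i (y i)) ->
  is_ses (ses_of_des d X y x).
Proof.
move=> [[cfE cfI cfS] bE] enum fresh selfless.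
have XyE i : X i `<=` des_events d /\ des_events d (y i).
  by apply: bE; apply/enum; exists i.
split=> /=.
- by split=> // a b /cfE[Ea Eb]; split; left.
- move=> c e [i [-> [] ->]]; split; try by right; exists i.
  by left; case: (XyE i).
- move=> m c e [i [-> -> Xm]]; have [XE _] := XyE i; split.
  + by left; apply: XE.
  + by exists i; split=> //; left.
  + by move=> mx; apply: (fresh i); rewrite -mx; apply: XE.
  + by move=> my; apply: (selfless i); rewrite -my.
Qed.

(* Main.v *)
Require Import Defs.

Set Implicit Arguments.
Unset Strict Implicit.
Unset Printing Implicit Defensive.

Local Open Scope classical_set_scope.

(** A fresh event [x i] causes itself and no drop targets it, so it never occurs
    in a trace of the SES.  Once only events of the DES are involved, the
    initial cause [x i] of [y i] can be met only by dropping it, that is by an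
    event of [X i]: both structures enable the same events from the same sets.
    Traces and causes depend on the enabling relation only through such sets. *)

Lemma before_mem (T : eqType) (t : seq T) (i : 'I_(size t)) :
  before i `<=` [set` t].
Proof. by move=> a /= /mem_take. Qed.

Lemma ev_mem (T : eqType) (t : seq T) (i : 'I_(size t)) : ev i \in t.
Proof. by rewrite /ev -[X in _ \in X]/(in_tuple t : seq T) mem_tnth. Qed.

Lemma ev_notin_before (T : eqType) (t : seq T) (i : 'I_(size t)) :
  uniq t -> ~ before i (ev i).
Proof.
move=> t_uniq; have evE : ev i = nth (ev i) t i by exact: tnth_nth.
have i_le : i <= size t by exact: ltnW.
(* Membership in the prefix means first index below [i]; in a duplicate-free [t] the first index of
   [ev i] is [i] itself. *)
by rewrite /before /= in_take_leq // evE index_uniq // ltnn.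
Qed.

Section EnablingExtensionality.
Variables (T : eqType) (en1 en2 : set T -> T -> Prop) (t : seq T).
Hypothesis en12 : forall (U : set T) (e : T),
  U `<=` [set` t] -> e \in t -> en1 U e <-> en2 U e.

Lemma enables_before_ext (i : 'I_(size t)) (U : set T) :
  U `<=` before i -> en1 U (ev i) <-> en2 U (ev i).
Proof.
move=> Ui; apply: en12; last exact: ev_mem.
exact: subset_trans Ui (@before_mem _ t i).
Qed.

(** The rivals [V] in the minimality clause also lie in [before i], where the two relations
    agree. *)
Lemma is_cause_ext (i : 'I_(size t)) (U : set T) :
  is_cause en1 i U <-> is_cause en2 i U.
Proof.
split=> -[Ui enU minU]; split=> //; first exact/enables_before_ext.
- by move=> V Vi enV VU; apply: minU => //; exact/enables_before_ext.
- exact/enables_before_ext.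
- by move=> V Vi enV VU; apply: minU => //; exact/enables_before_ext.
Qed.

Lemma trace_poset_ext : trace_poset en1 t = trace_poset en2 t.
Proof.
rewrite /trace_poset; suff -> : precedes en1 t = precedes en2 t by [].
apply/funext => c; apply/funext => e; apply/propext.
by split=> -[i [U [-> Ucause Uc]]]; exists i, U; split=> //; exact/is_cause_ext.
Qed.

Lemma enables_trace_ext :
  (forall i : 'I_(size t), en1 (before i) (ev i)) <->
  (forall i : 'I_(size t), en2 (before i) (ev i)).
Proof. by split=> en i; apply/enables_before_ext. Qed.

End EnablingExtensionality.

Section SesOfDes.
Variables (T : eqType) (d : des T) (I : Type) (X : I -> set T) (y x : I -> T).
Hypothesis d_des : is_des d.
Hypothesis bundles : enumerates_bundles d X y.
Hypothesis x_distinct : injective x.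
Hypothesis x_fresh : forall i : I, ~ des_events d (x i).

Local Notation s := (ses_of_des d X y x).

Lemma bundle_target_event (i : I) : des_events d (y i).
Proof.
by have [_ bE] := d_des; apply: (bE (X i) _ _).2; apply/bundles; exists i.
Qed.

Lemma ses_of_des_enables (U : set T) (e : T) :
  U `<=` des_events d -> des_events d e ->
  des_enables d U e <-> ses_enables s U e.
Proof.
move=> UE Ee; split=> [en c [[i [-> [ey|ex]]] ndc]|en A /bundles[i [-> ey]]].
- have /en[m [Xm Um]] : des_bundle d (X i) e by apply/bundles; exists i.
  by exfalso; apply: ndc; exists m => //; exists i.
- by case: (@x_fresh i); rewrite -ex.
(* If [x i] is dropped, the dropping event lies in some [X j] with [x i = x j], and distinctness
   turns [X j] into [X i]. Otherwise enabling would put the fresh [x i] into [U]. *)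
- have [[m Um [j [xij _ Xm]]]|ndc] := pselect (dc s U e (x i)).
    by exists m; split=> //; rewrite (x_distinct xij).
  case: (@x_fresh i); apply/UE/en; split=> //.
  by exists i; split=> //; left.
Qed.

Lemma ses_of_des_trace_events (t : seq T) :
  ses_trace s t -> [set` t] `<=` des_events d.
Proof.
move=> [tE t_uniq _ en] a /= a_t; have [//|[k _ xka]] := tE a a_t.
have /tnthP[i ai] : a \in in_tuple t by [].
(* Being its own undropped cause, [a] would have to precede itself in [t]. *)
case: (@ev_notin_before _ t i t_uniq); apply: en; rewrite /ev -ai; split.
  by exists k; split=> //; right.
(* A drop acting on the causes of [a] would make [a] some [y j], an event of [d]. *)
move=> [m _ [j [_ ayj _]]]; case: (@x_fresh k).
by rewrite xka ayj; exact: bundle_target_event.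
Qed.

Lemma ses_of_des_enables_in (t : seq T) : [set` t] `<=` des_events d ->
  forall (U : set T) (e : T),
    U `<=` [set` t] -> e \in t -> des_enables d U e <-> ses_enables s U e.
Proof.
move=> tE U e Ut et; apply: ses_of_des_enables; last exact: tE.
exact: subset_trans Ut tE.
Qed.

Lemma ses_of_des_trace (t : seq T) : des_trace d t <-> ses_trace s t.
Proof.
split=> [[tE t_uniq cf en]|tr].
  split=> //; first by move=> a /tE; left.
  exact/(enables_trace_ext (ses_of_des_enables_in tE)).
(* Fresh events are excluded first, since enabling is compared only within the events of [d]. *)
have tE := ses_of_des_trace_events tr; have [_ t_uniq cf en] := tr.
by split=> //; exact/(enables_trace_ext (ses_of_des_enables_in tE)).
Qed.

End SesOfDes.

Theorem theorem4p12 (T : eqType) (d : des T) (I : Type)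
    (X : I -> set T) (y x : I -> T)
    (d_des : is_des d)
    (bundles : enumerates_bundles d X y)
    (x_distinct : injective x)
    (x_fresh : forall i : I, ~ des_events d (x i)) :
  des_posets d = ses_posets (ses_of_des d X y x).
Proof.
have trE := ses_of_des_trace d_des bundles x_distinct x_fresh.
have poE t : des_trace d t -> trace_poset (des_enables d) t =
    trace_poset (ses_enables (ses_of_des d X y x)) t.
  move=> [tE _ _ _]; apply: trace_poset_ext.
  exact: ses_of_des_enables_in.
apply/seteqP; split=> p [t tr <-].
  by exists t; [exact/trE|rewrite poE].
by exists t; [exact/trE|rewrite poE //; exact/trE].
Qed.
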